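(* Let $r \ge 0$ be an integer and let $G$ be a finite simple graph with at least $3$ vertices such that $\delta(G) \ge (r+1)\widetilde{\alpha}(G) + 3r$. Then $G$ contains $r+1$ pairwise edge-disjoint Hamilton cycles.
   Context: $\delta(G)$ denotes the minimum degree of $G$. For disjoint vertex sets $S,T$, $E(S,T)$ is the set of edges with one end in $S$ and one in $T$. An $(s,t)$-bipartite-hole in $G$ consists of two disjoint sets of vertices $S$ and $T$ with $|S|=s$, $|T|=t$ and $E(S,T)=\emptyset$. The bipartite-hole-number $\widetilde{\alpha}(G)$ is the least integer $r'$ which can be written as $r'=s+t-1$ for some positive integers $s,t$ such that $G$ contains no $(s,t)$-bipartite-hole. *)

(* Defs.v *)
From mathcomp Require Import all_boot.
Set Implicit Arguments. Unset Strict Implicit. Unset Printing Implicit Defensive.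

Definition simple_graph (T : finType) (e : rel T) : Prop :=
  symmetric e /\ irreflexive e.

Definition nbhd (T : finType) (e : rel T) (x : T) : {set T} := [set y | e x y].

(* minimum degree delta(G) (for nonempty T; 0 by convention for empty T) *)
Definition min_degree (T : finType) (e : rel T) : nat :=
  \big[minn/#|T|]_(x : T) #|nbhd e x|.

Definition bip_hole (T : finType) (e : rel T) (s t : nat) : bool :=
  [exists S : {set T}, exists U : {set T},
     [&& #|S| == s, #|U| == t, [disjoint S & U] &
         [forall x in S, forall y in U, ~~ e x y]]].

Definition bhn_pred (T : finType) (e : rel T) (r' : nat) : bool :=
  [exists s : 'I_(r'.+2), exists t : 'I_(r'.+2),
     [&& 0 < s, 0 < t, s + t - 1 == r' & ~~ bip_hole e s t]].

Lemma bhn_exists (T : finType) (e : rel T) : exists r', bhn_pred e r'.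
Proof.
exists #|T|.+1. apply/existsP.
have H1 : 1 < #|T|.+3 by [].
have H2 : #|T|.+1 < #|T|.+3 by [].
exists (Ordinal H2); apply/existsP; exists (Ordinal H1) => /=.
rewrite addn1 subn1 /= eqxx /=.
rewrite /bip_hole; apply/negP; case/existsP => S; case/existsP => U.
case/and4P => /eqP HS _ _ _.
by move: (max_card S); rewrite HS ltnn.
Qed.

Definition bhn (T : finType) (e : rel T) : nat := ex_minn (bhn_exists e).

Definition hamilton_cycle (T : finType) (e : rel T) (c : seq T) : bool :=
  [&& uniq c, size c == #|T| & cycle e c].

Definition cycle_edges (T : finType) (c : seq T) : {set {set T}} :=
  [set [set x; next c x] | x in c].

(* Main.v *)
(* Let v_0 ... v_k be a longest path of a graph with no (s,t)-bipartite-hole and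
   minimum degree at least s + t - 1. All neighbours of v_0 and v_k lie on the
   path. Choose a threshold m such that at least s neighbours v_a of v_0 have
   a <= m and at least t have a >= m. If at least t neighbours v_b of v_k have
   b >= m, some edge joins a v_(a-1) with a <= m to a v_(b+1) with b >= m;
   otherwise at least s of them have b < m, and some edge joins a v_(b+1) with
   b < m to a v_(a+1) with a >= m. In both cases the edge closes the path into a
   cycle, which is Hamiltonian since otherwise an edge leaving it would give a
   longer path.
   Deleting k Hamilton cycles lowers every degree by at most 2k and turns "no
   (s,t)-hole" into "no (s,t+2ks)-hole"; when s <= t and s + t - 1 is the
   bipartite-hole-number, the degree hypothesis still yields another Hamilton
   cycle as long as k <= r. *)

Require Import Defs.
From mathcomp Require Import all_boot zify.

Set Implicit Arguments. Unset Strict Implicit. Unset Printing Implicit Defensive.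

(** * Reconnecting three consecutive pieces of a path into a cycle *)

Section Rotations.
Variables (T : eqType) (e : rel T).
Hypothesis e_sym : symmetric e.

Lemma sorted_cat_ends (x y : T) s1 s2 : s1 != [::] -> s2 != [::] ->
  sorted e (s1 ++ s2) = [&& sorted e s1, e (last x s1) (head y s2) & sorted e s2].
Proof. by case: s1 => // a s1 _; case: s2 => // b s2 _ /=; rewrite cat_path. Qed.

Lemma cycle_ends (x y : T) s : s != [::] ->
  cycle e s = sorted e s && e (last x s) (head y s).
Proof. by case: s => // a s _ /=; rewrite rcons_path. Qed.

Lemma sorted_rev_sym s : sorted e (rev s) = sorted e s.
Proof. by rewrite rev_sorted; apply: eq_sorted => x y; rewrite e_sym. Qed.

Lemma head_rev (x : T) s : head x (rev s) = last x s.
Proof. by case/lastP: s => // s a; rewrite rev_rcons last_rcons. Qed.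

Lemma last_rev (x : T) s : last x (rev s) = head x s.
Proof. by case: s => // a s; rewrite rev_cons last_rcons. Qed.

Lemma rev_neq_nil s : (rev s != [::] :> seq T) = (s != [::]).
Proof. by rewrite -!size_eq0 size_rev. Qed.

Lemma cat_neq_nil (s1 s2 : seq T) : (s1 ++ s2 != [::]) = (s1 != [::]) || (s2 != [::]).
Proof. by case: s1. Qed.

Variables (x : T) (P Q R : seq T).
Hypotheses (nP : P != [::]) (nQ : Q != [::]) (nR : R != [::]).
Hypothesis sPQR : sorted e (P ++ Q ++ R).

Let parts : [/\ sorted e P, sorted e Q & sorted e R].
Proof.
have nQR : Q ++ R != [::] by rewrite cat_neq_nil nQ.
move: sPQR; rewrite (sorted_cat_ends x x nP nQR) (sorted_cat_ends x x nQ nR).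
by case/and3P=> ? _ /and3P[].
Qed.

Let head_cat s1 s2 : s1 != [::] -> head x (s1 ++ s2) = head x s1.
Proof. by case: s1. Qed.

Let last_cat_ne s1 s2 : s2 != [::] -> last x (s1 ++ s2) = last x s2.
Proof. by case: s2 => // a s2; rewrite last_cat. Qed.

(** Traverse [P] backwards, jump from its head to [Q], run through [Q], jump to the end of [R] and
    go back; the third edge closes the cycle. *)
Lemma cycle_crossing : e (head x P) (head x Q) -> e (last x R) (last x Q) ->
  e (last x P) (head x R) -> cycle e (rev P ++ Q ++ rev R).
Proof.
have [sP sQ sR] := parts => ePQ eRQ ePR.
have nPQR : rev P ++ Q ++ rev R != [::] by rewrite cat_neq_nil rev_neq_nil nP.
have nQR : Q ++ rev R != [::] by rewrite cat_neq_nil nQ.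
rewrite (cycle_ends x x nPQR) (sorted_cat_ends x x) ?rev_neq_nil //.
rewrite (sorted_cat_ends x x) ?rev_neq_nil // !last_cat_ne ?rev_neq_nil // !head_cat ?rev_neq_nil //.
by rewrite !head_rev !last_rev !sorted_rev_sym sP sQ sR ePQ [e (last x Q) _]e_sym eRQ e_sym ePR.
Qed.

(** Here [Q] and [P] are both run forwards, joined from the end of [Q] to the head of [P], and only
    [R] is reversed. *)
Lemma cycle_noncrossing : e (head x P) (last x Q) -> e (last x R) (last x P) ->
  e (head x Q) (head x R) -> cycle e (Q ++ P ++ rev R).
Proof.
have [sP sQ sR] := parts => ePQ eRP eQR.
have nPQR : Q ++ P ++ rev R != [::] by rewrite cat_neq_nil nQ.
have nPR : P ++ rev R != [::] by rewrite cat_neq_nil nP.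
rewrite (cycle_ends x x nPQR) (sorted_cat_ends x x) //.
rewrite (sorted_cat_ends x x) ?rev_neq_nil // !last_cat_ne ?rev_neq_nil // !head_cat //.
by rewrite head_rev last_rev !sorted_rev_sym sP sQ sR e_sym ePQ [e (last x P) _]e_sym eRP e_sym eQR.
Qed.

End Rotations.

(** * Closing a path, in terms of positions on it *)

Section Closing.
Variables (T : eqType) (e : rel T) (x0 : T) (p : seq T).
Hypotheses (e_sym : symmetric e) (sp : sorted e p).
Local Notation v := (nth x0 p).

Let segment a b := take (b - a) (drop a p).

Let cut3 a b : a <= b -> p = take a p ++ segment a b ++ drop b p.
Proof.
move=> le_ab; rewrite -{1}(cat_take_drop a p); congr (_ ++ _).
by rewrite -{1}(cat_take_drop (b - a) (drop a p)) drop_drop subnK.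
Qed.

Let size_segment a b : a <= b -> b <= size p -> size (segment a b) = b - a.
Proof. by move=> ab bp; rewrite size_takel // size_drop leq_sub2r. Qed.

Let head_segment a b : a < b -> head x0 (segment a b) = v a.
Proof. by move=> ab; rewrite -nth0 nth_take ?subn_gt0 // nth_drop addn0. Qed.

Let last_segment a b : a < b -> b <= size p -> last x0 (segment a b) = v b.-1.
Proof.
move=> ab bp; rewrite -nth_last size_segment ?(ltnW ab) // nth_take ?nth_drop; last lia.
by congr (v _); lia.
Qed.

Let take_segment a : take a p = segment 0 a.
Proof. by rewrite /segment drop0 subn0. Qed.

Let drop_segment a : drop a p = segment a (size p).
Proof. by rewrite /segment take_oversize // size_drop. Qed.

Let nonempty a b : a < b -> b <= size p -> segment a b != [::].
Proof. by move=> ab bp; rewrite -size_eq0 size_segment ?(ltnW ab) //; lia. Qed.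

(** Cut just before [a] and just after [b]; the bounds make all three pieces nonempty. *)
Lemma close_crossing a b : 0 < a -> a <= b -> b.+1 < size p ->
  e (v 0) (v a) -> e (v (size p).-1) (v b) -> e (v a.-1) (v b.+1) ->
  exists2 c, perm_eq c p & cycle e c.
Proof.
move=> a0 ab bp ea eb eab; have ab1 : a <= b.+1 by lia.
have := cut3 ab1; rewrite take_segment drop_segment => Dp.
exists (rev (segment 0 a) ++ segment a b.+1 ++ rev (segment b.+1 (size p))).
  by rewrite [X in perm_eq _ X]Dp perm_cat ?perm_rev // perm_cat // perm_rev.
apply: (@cycle_crossing _ e e_sym x0); rewrite -?Dp // ?nonempty ?head_segment ?last_segment //; lia.
Qed.

(** Cut just after [b] and just after [a], so that the middle piece runs from [b.+1] to [a]. *)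
Lemma close_noncrossing a b : b < a -> a.+1 < size p ->
  e (v 0) (v a) -> e (v (size p).-1) (v b) -> e (v b.+1) (v a.+1) ->
  exists2 c, perm_eq c p & cycle e c.
Proof.
move=> ba ap ea eb eab; have ab1 : b.+1 <= a.+1 by lia.
have := cut3 ab1; rewrite take_segment drop_segment => Dp.
exists (segment b.+1 a.+1 ++ segment 0 b.+1 ++ rev (segment a.+1 (size p))).
  by rewrite [X in perm_eq _ X]Dp perm_catCA perm_cat // perm_cat // perm_rev.
apply: (@cycle_noncrossing _ e e_sym x0); rewrite -?Dp // ?nonempty ?head_segment ?last_segment //; lia.
Qed.

Lemma close_ends : p != [::] -> e (v 0) (v (size p).-1) -> cycle e p.
Proof. by move=> p0 e0; rewrite (cycle_ends e x0 x0 p0) sp -nth_last -nth0 e_sym. Qed.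

End Closing.

(** * A Hamilton cycle from large degree and the absence of a bipartite hole *)

Section BipartiteHoles.
Variables (T : finType) (e : rel T).

(** [bip_hole] asks for exact sizes, so [S] and [U] are first cut down to subsets of [s] and [t]
    elements. *)
Lemma no_hole_edge s t (S U : {set T}) : ~~ bip_hole e s t ->
  s <= #|S| -> t <= #|U| -> [disjoint S & U] ->
  exists x y, [/\ x \in S, y \in U & e x y].
Proof.
move=> nh /card_geqP[s1 [us1 Ds sS]] /card_geqP[s2 [us2 Dt sU]] dSU.
have [/existsP[x /existsP[y /and3P[xS yU exy]]]|nE] :=
  boolP [exists x, exists y, [&& x \in S, y \in U & e x y]]; first by exists x, y.
case/negP: nh; apply/existsP; exists [set z in s1]; apply/existsP; exists [set z in s2].
rewrite !cardsE (card_uniqP us1) (card_uniqP us2) Ds Dt !eqxx /=; apply/andP; split.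
  apply: disjointWl (disjointWr _ dSU); apply/subsetP=> z; rewrite inE; [exact: sS | exact: sU].
apply/forall_inP=> x; rewrite inE => /sS xS; apply/forall_inP=> y; rewrite inE => /sU yU.
by apply: contra nE => exy; apply/existsP; exists x; apply/existsP; exists y; rewrite xS yU.
Qed.

Lemma longest_path : exists2 p : seq T, uniq p && sorted e p &
  forall q, uniq q -> sorted e q -> size q <= size p.
Proof.
pose P n := [exists t : n.-tuple T, uniq t && sorted e t].
have exP : exists n, P n by exists 0; apply/existsP; exists [tuple].
have ubP n : P n -> n <= #|T|.
  by case/existsP=> t /andP[ut _]; rewrite -(size_tuple t) -(card_uniqP ut) max_card.
case: (ex_maxnP exP ubP) => n /existsP[t tP] max_n; exists t => // q uq sq.
by rewrite size_tuple max_n //; apply/existsP; exists (in_tuple q); rewrite uq.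
Qed.

Variables s t : nat.
Hypotheses (e_sym : symmetric e) (e_irr : irreflexive e).
Hypotheses (s_gt0 : 0 < s) (t_gt0 : 0 < t) (no_hole : ~~ bip_hole e s t).
Hypothesis deg_e : forall x, s + t - 1 <= #|nbhd e x|.

(** If [V] missed a vertex, [V] and its complement would both be closed under neighbours, so each
    would contain some vertex with its whole neighbourhood, at least [s + t] vertices. An edge
    between them would then exist, against closure. *)
Lemma closed_set_full (V : {set T}) x : x \in V ->
  (forall y z, y \in V -> e y z -> z \in V) -> V = setT.
Proof.
have big (W : {set T}) w : w \in W -> nbhd e w \subset W -> s + t <= #|W|.
  move=> wW sNW; have : w |: nbhd e w \subset W by rewrite subUset sub1set wW.
  by move/subset_leq_card; rewrite cardsU1 inE e_irr /=; have := deg_e w; lia.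
move=> xV clV; apply/eqP; rewrite -subTset; apply/subsetP=> z _; apply/negPn/negP=> zV.
have bV : s + t <= #|V| by apply: (big _ x) => //; apply/subsetP=> y; rewrite inE; exact: clV.
have bC : s + t <= #|~: V|.
  apply: (big _ z); first by rewrite inE.
  by apply/subsetP=> y; rewrite !inE => ezy; apply: contra zV => yV; apply: clV yV _; rewrite e_sym.
have dV : [disjoint V & ~: V] by rewrite -setI_eq0 setICr.
have [||y [w [yV wV eyw]]] := no_hole_edge no_hole _ _ dV; [lia..|].
by move: wV; rewrite inE (clV y w).
Qed.

Lemma longest_path_cycle p : p != [::] -> uniq p -> sorted e p ->
  (forall q, uniq q -> sorted e q -> size q <= size p) ->
  exists2 c, perm_eq c p & cycle e c.
Proof.
case: p => // x0 p'; set p := x0 :: p' => p0 up sp maxp.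
pose v := nth x0 p; pose ix z := index z p; pose y0 := v (size p).-1.
have Nx z : e x0 z -> z \in p.
  move=> exz; apply/negPn/negP=> zp; suff: size (z :: p) <= size p by rewrite ltnn.
  by apply: maxp; [rewrite cons_uniq zp | rewrite /= e_sym exz].
have Ny z : e y0 z -> z \in p.
  move=> eyz; apply/negPn/negP=> zp.
  suff: size (rcons p z) <= size p by rewrite size_rcons ltnn.
  apply: maxp; first by rewrite rcons_uniq zp.
  by rewrite /= rcons_path -[last _ _]/(last x0 p) -nth_last eyz andbT.
have vix z : z \in p -> v (ix z) = z by move=> zp; rewrite /v nth_index.
have ixv i : i < size p -> ix (v i) = i by move=> ip; rewrite /ix index_uniq.
have ltix z : z \in p -> ix z < size p by rewrite /ix index_mem.
pose A := nbhd e x0; pose B := nbhd e y0.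
have Ap z : z \in A -> 0 < ix z.
  rewrite inE lt0n => exz; apply/eqP=> iz; have := vix z (Nx z exz).
  by rewrite iz /v /= => xz; rewrite -xz e_irr in exz.
have Bp z : z \in B -> (ix z).+1 < size p.
  rewrite inE => eyz; have zp := Ny z eyz; have := ltix z zp.
  rewrite leq_eqVlt => /orP[/eqP iz|//]; move: (vix z zp) eyz.
  by rewrite -[ix z]/(ix z).+1.-1 iz -/y0 => <-; rewrite e_irr.
(* If the ends are adjacent, the path itself closes up. Otherwise no neighbour of [x0] is the last
   vertex, so each has a successor on the path. *)
have [e_xy|ne_xy] := boolP (e x0 y0); first by exists p => //; apply: (close_ends (x0 := x0)).
have Ap1 z : z \in A -> (ix z).+1 < size p.
  rewrite inE => exz; have zp := Nx z exz; have := ltix z zp.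
  rewrite leq_eqVlt => /orP[/eqP iz|//]; move: (vix z zp) exz.
  by rewrite -[ix z]/(ix z).+1.-1 iz -/y0 => <-; rewrite (negPf ne_xy).
pose Ale m := [set z in A | ix z <= m]; pose Age m := [set z in A | m <= ix z].
pose Blt m := [set z in B | ix z < m]; pose Bge m := [set z in B | m <= ix z].
have [m sA tA] : exists2 m, s <= #|Ale m| & t <= #|Age m|.
  have exm : exists m, s <= #|Ale m|.
    exists (size p); suff -> : Ale (size p) = A by have := deg_e x0; rewrite -/A; lia.
    by apply/setP=> z; rewrite inE; apply: andb_idr => /Ap1; lia.
  case: (ex_minnP exm) => m sm min_m; exists m => //.
  (* By minimality of [m], fewer than [s] vertices of [A] have index below [m], which leaves at
     least [t] in [Age m]. *)
  have lt_s : #|A :\: Age m| < s.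
    rewrite ltnNge; apply/negP=> sC; case: m => [|m] in sm min_m sC.
      suff A0 : A :\: Age 0 = set0 by move: sC; rewrite A0 cards0; lia.
      by apply/setP=> z; rewrite !inE; case: (e x0 z).
    have: m.+1 <= m; last by rewrite ltnn.
    apply: min_m; apply: leq_trans sC (subset_leq_card _); apply/subsetP=> z.
    by rewrite !inE; case: (e x0 z); rewrite //= andbT -ltnNge.
  have sub : Age m \subset A by apply/subsetP=> z; rewrite inE => /andP[].
  have := cardsD A (Age m); rewrite (setIidPr sub).
  by have := subset_leq_card sub; have := deg_e x0; rewrite -/A; lia.
(* [Ap], [Ap1] and [Bp] keep these shifts on the path, clear of truncation at 0 and of the default
   of [nth]; so they are injective where used. *)
pose pr z := v (ix z).-1; pose sc z := v (ix z).+1.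
have ix_pr z : z \in A -> ix (pr z) = (ix z).-1.
  by move=> zA; have := Ap1 z zA => zp; rewrite ixv //; lia.
have ix_scA z : z \in A -> ix (sc z) = (ix z).+1 by move=> zA; rewrite ixv // Ap1.
have ix_scB z : z \in B -> ix (sc z) = (ix z).+1 by move=> zB; rewrite ixv // Bp.
have Ain z : z \in A -> z \in p by rewrite inE; exact: Nx.
have Bin z : z \in B -> z \in p by rewrite inE; exact: Ny.
have card_pr (W : {set T}) : W \subset A -> #|pr @: W| = #|W|.
  move/subsetP=> WA; apply: card_in_imset => y z /WA yA /WA zA.
  move/(congr1 ix); rewrite !ix_pr // => yz.
  rewrite -(vix y) ?Ain // -(vix z) ?Ain //; congr v.
  by have := Ap y yA; have := Ap z zA; lia.
have card_scA (W : {set T}) : W \subset A -> #|sc @: W| = #|W|.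
  move/subsetP=> WA; apply: card_in_imset => y z /WA yA /WA zA.
  move/(congr1 ix); rewrite !ix_scA // => -[yz].
  by rewrite -(vix y) ?Ain // -(vix z) ?Ain // yz.
have card_scB (W : {set T}) : W \subset B -> #|sc @: W| = #|W|.
  move/subsetP=> WB; apply: card_in_imset => y z /WB yB /WB zB.
  move/(congr1 ix); rewrite !ix_scB // => -[yz].
  by rewrite -(vix y) ?Bin // -(vix z) ?Bin // yz.
have sub (W : {set T}) (P : pred T) : [set z in W | P z] \subset W.
  by apply/subsetP=> z; rewrite inE => /andP[].
have [tB|tB] := leqP t #|Bge m|.
  have [|||x [y [/imsetP[a aA ->] /imsetP[b bB ->] exy]]] :=
    @no_hole_edge s t (pr @: Ale m) (sc @: Bge m) no_hole.
  - by rewrite card_pr ?sub.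
  - by rewrite card_scB ?sub.
  (* Predecessors of [Ale m] have index below [m], successors of [Bge m] index above [m]. *)
  - rewrite -setI_eq0; apply/eqP/setP=> z; rewrite [RHS]inE; apply/negP.
    case/setIP=> /imsetP[a aA za] /imsetP[b bB zb].
    move: aA bB; rewrite !inE -!(in_set (e _)) => /andP[aA am] /andP[bB bm].
    have := ix_pr a aA; have := ix_scB b bB; rewrite -za -zb => -> .
    by move: (Ap a aA); lia.
  move: aA bB; rewrite inE => /andP[aA am]; rewrite inE => /andP[bB bm].
  apply: (@close_crossing _ e x0 p e_sym sp (ix a) (ix b)); rewrite ?Ap ?Bp //.
  - exact: leq_trans bm.
  - by rewrite -/v vix ?Ain //; move: aA; rewrite inE.
  - by rewrite -/v vix ?Bin //; move: bB; rewrite inE.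
have sB : s <= #|Blt m|.
  have : B = Bge m :|: Blt m.
    by apply/setP=> z; rewrite !inE -andb_orr; case: leqP; rewrite andbT.
  move/(congr1 (fun X : {set T} => #|X|)); rewrite cardsU.
  by have := deg_e y0; rewrite -/B; lia.
have [|||x [y [/imsetP[b bB ->] /imsetP[a aA ->] exy]]] :=
  @no_hole_edge s t (sc @: Blt m) (sc @: Age m) no_hole.
- by rewrite card_scB ?sub.
- by rewrite card_scA ?sub.
(* Successors of [Blt m] have index at most [m], those of [Age m] index above [m]. *)
- rewrite -setI_eq0; apply/eqP/setP=> z; rewrite [RHS]inE; apply/negP.
  case/setIP=> /imsetP[b bB zb] /imsetP[a aA za].
  move: aA bB; rewrite inE => /andP[aA am]; rewrite inE => /andP[bB bm].
  by have := ix_scA a aA; have := ix_scB b bB; rewrite -za -zb => ->; lia.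
move: aA bB; rewrite inE => /andP[aA am]; rewrite inE => /andP[bB bm].
apply: (@close_noncrossing _ e x0 p e_sym sp (ix a) (ix b)); rewrite ?Ap1 //.
- exact: leq_trans am.
- by rewrite -/v vix ?Ain //; move: aA; rewrite inE.
- by rewrite -/v vix ?Bin //; move: bB; rewrite inE.
Qed.

Theorem hamilton_cycle_of_no_hole : 0 < #|T| -> exists c, hamilton_cycle e c.
Proof.
move=> /card_gt0P[x0 _]; have [p /andP[up sp] maxp] := longest_path.
have p0 : p != [::] by apply/eqP=> p0; have := maxp [:: x0] isT isT; rewrite p0.
have [c pc cc] := longest_path_cycle p0 up sp maxp.
have uc : uniq c by rewrite (perm_uniq pc).
have szc : size c = size p by apply: perm_size.
have [y yc] : exists y, y \in c.
  case: c szc {pc cc uc} => [|y c] szc; last by exists y; rewrite mem_head.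
  by case: p p0 szc {up sp maxp}.
exists c; apply/and3P; split=> //.
suff V1 : [set z in c] = setT by rewrite -(card_uniqP uc) -cardsE V1 cardsT.
apply: (@closed_set_full _ y); rewrite ?inE // => a b; rewrite !inE => ac eab.
(* Opening the cycle at [a] and prepending an outside neighbour [b] would give a path longer than
   [p]. *)
apply/negPn/negP=> bc; have [i c' rc] := rot_to ac.
suff: size (b :: rot i c) <= size p by rewrite /= size_rot szc ltnn.
apply: maxp; first by rewrite cons_uniq mem_rot bc rot_uniq.
move: cc; rewrite -(rot_cycle i) rc /= rcons_path => /andP[pc' _].
by rewrite [e b a]e_sym eab.
Qed.

End BipartiteHoles.

(** * Effect of deleting cycles on degrees and holes *)

Section RemoveCycles.
Variables (T : finType) (e : rel T) (cs : seq (seq T)).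
Hypotheses (e_sym : symmetric e) (cs_uniq : all uniq cs).

Definition remove_cycles : rel T :=
  fun x y => e x y && all (fun c => [set x; y] \notin cycle_edges c) cs.

Lemma remove_cycles_sym : symmetric remove_cycles.
Proof. by move=> x y; rewrite /remove_cycles e_sym setUC. Qed.

Lemma card_cycle_nbrs (c : seq T) x :
  uniq c -> #|[set y | [set x; y] \in cycle_edges c]| <= 2.
Proof.
move=> uc; have sub2 : [set y | [set x; y] \in cycle_edges c] \subset [set next c x; prev c x].
  (* The equality of pairs is evaluated at single vertices. The cases with [next c z = z] are
     one-vertex cycles, whose pair collapses to a singleton. *)
  apply/subsetP=> y; rewrite !inE => /imsetP[z zc /setP Dz].
  have := Dz x; rewrite !inE eqxx /= => /esym/orP[]/eqP xz.
    have := Dz (next c z); rewrite !inE eqxx orbT -xz => /orP[]/eqP nx.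
      by have := Dz y; rewrite !inE -xz nx eqxx !orbT orbb => <-.
    by rewrite nx eqxx.
  have := Dz z; rewrite !inE eqxx /= => /orP[]/eqP zxy.
    by have := Dz y; rewrite !inE -xz zxy eqxx orbT orbb => /esym/eqP->; rewrite {1}xz zxy eqxx.
  by rewrite xz prev_next // zxy eqxx orbT.
by apply: leq_trans (subset_leq_card sub2) _; rewrite cards2; case: (_ != _).
Qed.

Lemma card_removed_nbrs x :
  #|[set y | has (fun c => [set x; y] \in cycle_edges c) cs]| <= 2 * size cs.
Proof.
elim: cs cs_uniq => [|c l IHl] /=; first by rewrite (eq_card0 (A := _)) // => y; rewrite inE.
case/andP=> uc ul; have := card_cycle_nbrs x uc; have := IHl ul.
set L := [set y | has _ _]; set N := [set y | _ \in _].
have -> : [set y | ([set x; y] \in cycle_edges c) || has (fun c => [set x; y] \in cycle_edges c) l] = N :|: L.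
  by apply/setP=> y; rewrite !inE.
by rewrite cardsU; lia.
Qed.

Lemma remove_cyclesE x y :
  remove_cycles x y = e x y && ~~ has (fun c => [set x; y] \in cycle_edges c) cs.
Proof. by rewrite -all_predC. Qed.

Lemma card_nbhd_remove_cycles x :
  #|nbhd e x| <= #|nbhd remove_cycles x| + 2 * size cs.
Proof.
apply: leq_trans (leq_add (leqnn _) (card_removed_nbrs x)).
apply: leq_trans (leq_card_setU _ _); apply/subset_leq_card/subsetP=> y.
by rewrite !inE remove_cyclesE => ->; case: has.
Qed.

(* The at most [2 * size cs * s] vertices joined to the first side by a deleted
   edge are discarded from the second side. *)
Lemma remove_cycles_no_hole s t : ~~ bip_hole e s t ->
  ~~ bip_hole remove_cycles s (t + 2 * size cs * s).
Proof.
move=> nh; apply/negP=> /existsP[S /existsP[U /and4P[/eqP cS /eqP cU dSU /forall_inP hSU]]].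
pose D := \bigcup_(x in S) [set y | has (fun c => [set x; y] \in cycle_edges c) cs].
have cD : #|D| <= 2 * size cs * s.
  rewrite -cS mulnC -sum_nat_const.
  apply: (big_ind2 (fun (A : {set T}) n => #|A| <= n)) => [|A m B n mA nB|x _].
  - by rewrite cards0.
  - by apply: leq_trans (leq_card_setU _ _) _; apply: leq_add.
  - exact: card_removed_nbrs.
have [|||x [y [xS /setDP[yU yD] exy]]] := @no_hole_edge _ _ s t S (U :\: D) nh.
- by rewrite cS.
- by rewrite cardsD cU; have := subset_leq_card (subsetIr U D); lia.
- by apply: disjointWr dSU; rewrite subsetDl.
have /forall_inP/(_ y yU) := hSU x xS.
rewrite remove_cyclesE exy /= negbK => xy; case/negP: yD.
by apply/bigcupP; exists x; rewrite // inE.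
Qed.

End RemoveCycles.

(** * Packing edge-disjoint Hamilton cycles *)

Lemma min_degree_le (T : finType) (e : rel T) x : min_degree e <= #|nbhd e x|.
Proof.
rewrite /min_degree; elim: (index_enum T) (mem_index_enum x) => // y l IHl.
by rewrite inE big_cons geq_min => /orP[/eqP->|/IHl->]; rewrite ?leqnn ?orbT.
Qed.

(** The two sides of a hole can be exchanged, so the smaller size may come first; this bounds
    [2 * s] by [bhn e + 1]. *)
Lemma bhn_witness (T : finType) (e : rel T) : symmetric e ->
  exists s t, [/\ 0 < s, s <= t, s + t - 1 = bhn e & ~~ bip_hole e s t].
Proof.
move=> e_sym; rewrite /bhn; case: ex_minnP => n.
case/existsP=> s /existsP[t /and4P[s0 t0 /eqP st nh]] _.
have [le_st|/ltnW le_ts] := leqP s t; first by exists s, t.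
exists t, s; split=> //; first by rewrite addnC.
apply: contra nh => /existsP[S /existsP[U /and4P[cS cU dSU /forall_inP hSU]]].
apply/existsP; exists U; apply/existsP; exists S; rewrite cS cU disjoint_sym dSU /=.
apply/forall_inP=> x xU; apply/forall_inP=> y yS; rewrite e_sym.
by have /forall_inP/(_ x xU) := hSU y yS.
Qed.

Theorem theorem3 (T : finType) (e : rel T) (r : nat) :
  simple_graph e ->
  3 <= #|T| ->
  (r.+1 * bhn e + 3 * r <= min_degree e)%N ->
  exists C : 'I_r.+1 -> seq T,
    (forall i, hamilton_cycle e (C i)) /\
    (forall i j, i != j -> [disjoint cycle_edges (C i) & cycle_edges (C j)]).
Proof.
case=> e_sym e_irr T3 deg_e.
have [s [t [s0 st Dbhn nh]]] := bhn_witness e_sym.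
pose disj (c d : seq T) := [disjoint cycle_edges c & cycle_edges d].
have ex_cs k : k <= r.+1 ->
    exists cs, [/\ size cs = k, all (hamilton_cycle e) cs & pairwise disj cs].
  elim: k => [|k IHk] lt_kr; first by exists [::].
  have [cs [sz_cs ham_cs disj_cs]] := IHk (ltnW lt_kr).
  have cs_uniq : all uniq cs by apply: sub_all ham_cs => c /and3P[].
  pose e' := remove_cycles e cs.
  have e'_irr : irreflexive e' by move=> x; rewrite /e' /remove_cycles e_irr.
  have nh' := remove_cycles_no_hole cs_uniq nh; rewrite sz_cs in nh'.
  have [|x||c ham_c] := hamilton_cycle_of_no_hole (remove_cycles_sym cs e_sym) e'_irr s0 _ nh'.
  - lia.
  (* With [b = bhn e], the need is [b + 2 * k * s + 2 * k <= min_degree e]. Since [2 * s <= b + 1],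
     the left side is at most [(k + 1) * b + 3 * k], and [k <= r]. *)
  - have := card_nbhd_remove_cycles e cs_uniq x; have := min_degree_le e x.
    rewrite sz_cs -/e'; nia.
  - lia.
  case/and3P: ham_c => uc sz_c cyc_c; exists (c :: cs); split=> /=.
  - by rewrite sz_cs.
  - rewrite ham_cs andbT /hamilton_cycle uc sz_c; apply: sub_cycle cyc_c.
    by move=> x y /andP[].
  (* Every edge of the new cycle is an edge of [e'], hence lies on no earlier cycle. *)
  rewrite disj_cs andbT; apply/allP=> d d_cs; rewrite /disj -setI_eq0.
  apply/eqP/setP=> E; rewrite !inE; apply/negP=> /andP[/imsetP[x xc ->]].
  by apply/negP; have /andP[_ /allP/(_ d d_cs)] := next_cycle cyc_c xc.
have [cs [sz_cs ham_cs /(pairwiseP [::]) disj_cs]] := ex_cs r.+1 (leqnn _).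
exists (fun i => nth [::] cs i); split=> [i|i j].
  by apply: (allP ham_cs); rewrite mem_nth // sz_cs.
wlog lt_ij : i j / i < j => [IH|_].
  rewrite neq_ltn => /orP[ij|ij]; first by apply: IH; rewrite // neq_ltn ij.
  by rewrite disjoint_sym; apply: IH; rewrite // neq_ltn ij.
by apply: disj_cs; rewrite // inE sz_cs.
Qed.
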